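(* There exists an absolute constant $c>0$ such that for every positive integer $n$ there exists an $n$-element set $P\subset \mathbb{R}^2$ whose box-Delaunay graph $G=D_{\mathrm{box}}(P)$ satisfies $$\alpha(G)\leq n\,2^{-c\sqrt{\log n}}\quad\text{and}\quad \chi(G)\geq 2^{c\sqrt{\log n}}.$$
   Context: For a finite set of points $P\subset\mathbb{R}^2$, the box-Delaunay graph $D_{\mathrm{box}}(P)$ is the graph on vertex set $P$ in which two distinct points $x,y\in P$ are joined by an edge if there exists a (closed) axis-parallel rectangle containing $x$ and $y$ but no other element of $P$. For a graph $G$, $\alpha(G)$ denotes its independence number (the maximum size of a set of pairwise non-adjacent vertices) and $\chi(G)$ its chromatic number. The base of $\log$ (any fixed base greater than $1$) is immaterial, as it only affects the constant $c$. *)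

(* Defs.v *)
From HB Require Import structures.
From mathcomp Require Import all_boot all_order all_algebra finmap.
From mathcomp Require Import all_classical all_reals.

Set Implicit Arguments.
Unset Strict Implicit.
Unset Printing Implicit Defensive.

Import Order.TTheory GRing.Theory Num.Theory.

Local Open Scope classical_set_scope.
Local Open Scope ring_scope.

Record sgraph := SGraph {
  vertex :> finType;
  adj : rel vertex;
  adj_sym : symmetric adj;
  adj_irr : irreflexive adj }.

Section GraphParameters.
Variable G : sgraph.

Definition independent (S : {set G}) : bool :=
  [forall x in S, forall y in S, ~~ adj x y].

Definition independence_number : nat :=
  (\max_(S : {set G} | independent S) #|S|)%N.

Definition proper_coloring (k : nat) (f : {ffun G -> 'I_k}) : bool :=
  [forall x, forall y, adj x y ==> (f x != f y)].

Definition colorable (k : nat) : bool :=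
  [exists f : {ffun G -> 'I_k}, proper_coloring f].

Lemma ex_colorable : exists k, colorable k.
Proof.
exists #|G|; apply/existsP; exists [ffun x => enum_rank x].
apply/forallP => x; apply/forallP => y; apply/implyP => xy.
rewrite !ffunE; apply/eqP => /enum_rank_inj exy.
by move: xy; rewrite exy adj_irr.
Qed.

Definition chromatic_number : nat := ex_minn ex_colorable.

End GraphParameters.

Section BoxDelaunay.
Variable R : realType.

(* The rectangle [a.1, b.1] x [a.2, b.2]. Degenerate rectangles are allowed;
   as P is finite and rectangles are closed, a degenerate one can be thickened
   without meeting further points of P, so the graph below is the same as with
   nondegenerate rectangles only. *)
Definition box (a b : R * R) : set (R * R) :=
  `[a.1, b.1]%classic `*` `[a.2, b.2]%classic.

Definition box_adj (P : {fset R * R}) : rel P := fun x y =>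
  `[< x <> y /\ exists a b : R * R,
        [set z | z \in P] `&` box a b = [set val x; val y] >].

Lemma box_adj_sym (P : {fset R * R}) : symmetric (@box_adj P).
Proof.
move=> x y; apply/asboolP/asboolP => -[nxy [a [b e]]];
  by split; [exact/nesym | exists a, b; rewrite e setUC].
Qed.

Lemma box_adj_irr (P : {fset R * R}) : irreflexive (@box_adj P).
Proof. by move=> x; apply/asboolP => -[]. Qed.

Definition box_delaunay (P : {fset R * R}) : sgraph :=
  SGraph (@box_adj_sym P) (@box_adj_irr P).

End BoxDelaunay.

(* Main.v *)
(* Only edges between u < v in the dominance order are used: these are the
   covers of a two-dimensional poset.

   The point set is built in u rounds. A round replaces a set V of N points by
   k = T * B copies of it, T = 16 ^ u, B >= 64 ^ u, side by side, so that the
   copies of each v in V form a horizontal strip. The strip of v carries its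
   own permutation: the decreasing one, except that the two halves of every
   node at a level r v of the binary tree over the T blocks of B copies are
   exchanged. Two copies of v in blocks that branch at level r v are adjacent.

   Independent sets are followed through containers: at most 2 ^ D sets of size
   at most m, one of which contains any given independent set. After a round an
   independent set is described by one old container for each of the k copies
   and, for each v, the set of blocks that its copies of v lie in, so D becomes
   D * k + T * N; the ratio D / (N * k) grows only by 1 / B. The blocks used by
   v may not branch at level r v. For a dense set of blocks a random level
   destroys in expectation a constant proportion (sum_hits), so a union bound
   over the T-tuples of old containers, which is affordable because D * T is
   small against m, yields levels r for which the containers shrink to
   15/16 * m * k. Thus n is about 2 ^ (10 * u ^ 2) and the independence ratio at
   most about (15 / 16) ^ u. *)

Require Import Defs.
From HB Require Import structures.
From mathcomp Require Import all_boot all_order all_algebra finmap.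
From mathcomp Require Import all_classical all_reals.
From mathcomp Require Import sequences exp.
From mathcomp Require Import zify ring lra.

Set Implicit Arguments.
Unset Strict Implicit.
Unset Printing Implicit Defensive.

Import Order.TTheory GRing.Theory Num.Theory.

Local Open Scope nat_scope.

(** * Covers in the dominance order and lexicographic products of point sets *)

Definition hasse (V : finType) (x y : V -> nat) (u v : V) : bool :=
  [&& x u < x v, y u < y v &
      [forall w, ~~ [&& x u < x w, x w < x v, y u < y w & y w < y v]]].

Definition hasse_free (V : finType) (x y : V -> nat) (I : {set V}) : bool :=
  [forall u in I, forall v in I, ~~ hasse x y u v].

Lemma hasseP (V : finType) (x y : V -> nat) (u v : V) :
  reflect [/\ x u < x v, y u < y v &
      forall w, x u < x w -> x w < x v -> y u < y w -> y w < y v -> False]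
    (hasse x y u v).
Proof.
apply: (iffP and3P) => -[xuv yuv H]; split=> //.
  by move=> w h1 h2 h3 h4; move/forallP/(_ w): H; rewrite h1 h2 h3 h4.
by apply/forallP => w; apply/negP => /and4P[]; exact: H.
Qed.

Lemma hasse_freeP (V : finType) (x y : V -> nat) (I : {set V}) :
  reflect {in I &, forall u v, ~~ hasse x y u v} (hasse_free x y I).
Proof.
apply: (iffP forall_inP) => H u; first by move=> v uI vI; exact: (forall_inP (H u uI)).
by move=> uI; apply/forall_inP => v vI; exact: H.
Qed.

Lemma ltn_lex X a b i j : i < X -> j < X ->
  (a * X + i < b * X + j) = (a < b) || (a == b) && (i < j).
Proof.
move=> iX jX; case: (ltngtP a b) => [ab|ba|->] /=; last by rewrite ltn_add2l.
- by apply/idP; nia.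
- by apply/negbTE; rewrite -leqNgt; nia.
Qed.

(* A copy of V for every a : A. The abscissa compares the copy first, the
   ordinate the point of V first, so that the copies of a point v form a
   horizontal strip, in which A is ordered by p and g v. *)
Section LexProduct.
Variables (V A : finType) (x y : V -> nat) (p : A -> nat) (g : V -> A -> nat).
Hypotheses (x_inj : injective x) (y_inj : injective y).
Hypotheses (p_inj : injective p) (g_inj : forall v, injective (g v)).

Definition lex_x (z : V * A) : nat := p z.2 * (\max_v x v).+1 + x z.1.
Definition lex_y (z : V * A) : nat :=
  y z.1 * (\max_(z' : V * A) g z'.1 z'.2).+1 + g z.1 z.2.

Lemma lex_xE z z' :
  (lex_x z < lex_x z') = (p z.2 < p z'.2) || (p z.2 == p z'.2) && (x z.1 < x z'.1).
Proof. by apply: ltn_lex; rewrite ltnS; exact: leq_bigmax. Qed.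

Lemma lex_yE z z' :
  (lex_y z < lex_y z') =
    (y z.1 < y z'.1) || (y z.1 == y z'.1) && (g z.1 z.2 < g z'.1 z'.2).
Proof.
apply: ltn_lex; rewrite ltnS.
  exact: (leq_bigmax (F := fun z : V * A => g z.1 z.2)).
exact: (leq_bigmax (F := fun z : V * A => g z.1 z.2)).
Qed.

Lemma lex_x_inj : injective lex_x.
Proof.
move=> [v a] [w b] e.
have := lex_xE (v, a) (w, b); have := lex_xE (w, b) (v, a).
rewrite e ltnn /=; case: (ltngtP (p a) (p b)) => //= /p_inj ->.
by case: (ltngtP (x v) (x w)) => //= /x_inj ->.
Qed.

Lemma lex_y_inj : injective lex_y.
Proof.
move=> [v a] [w b] e.
have := lex_yE (v, a) (w, b); have := lex_yE (w, b) (v, a).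
rewrite e ltnn /=; case: (ltngtP (y v) (y w)) => //= /y_inj <-.
by case: (ltngtP (g v a) (g v b)) => //= /g_inj ->.
Qed.

(** A point between the two in abscissa lies in copy [a] itself, where the orders of [V] decide. *)
Lemma hasse_lex1 a v w : hasse x y v w -> hasse lex_x lex_y (v, a) (w, a).
Proof.
move=> /hasseP[xvw yvw H]; apply/hasseP; rewrite lex_xE lex_yE /= eqxx xvw yvw orbT.
split=> // -[u c]; rewrite !lex_xE !lex_yE /=.
case: (ltngtP (p a) (p c)) => //= _ xvu xuw.
case: (ltngtP (y v) (y u)) => [yvu _|//|/y_inj e]; last by rewrite e ltnn in xvu.
case: (ltngtP (y u) (y w)) => [yuw _|//|/y_inj e]; last by rewrite e ltnn in xuw.
exact: (H u).
Qed.

(** A point between the two in ordinate lies in the strip of [v], so only copies of [v] can come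
    between them. *)
Lemma hasse_lex2 v a b : hasse p (g v) a b -> hasse lex_x lex_y (v, a) (v, b).
Proof.
move=> /hasseP[pab gab H]; apply/hasseP; rewrite lex_xE lex_yE /= eqxx pab gab orbT.
split=> // -[u c]; rewrite !lex_xE !lex_yE /= => h1 h2 h3 h4.
have yE : y v = y u by move: h3 h4; case: ltngtP.
have vE := y_inj yE; rewrite -vE !eqxx !ltnn /= !andbF !orbF in h1 h2 h3 h4.
exact: (H c).
Qed.

End LexProduct.

(** * Branching in a binary tree *)

(** An even block of length [2 ^ r] and its successor are the left and right halves of one node of
    the tree. *)
Definition branch (r b b' : nat) : bool :=
  (~~ odd (b %/ 2 ^ r)) && ((b %/ 2 ^ r).+1 == b' %/ 2 ^ r).

Lemma branch_shift t r b b' : r < t ->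
  branch r (2 ^ t + b) (2 ^ t + b') = branch r b b'.
Proof.
move=> rt; have E : 2 ^ t = 2 ^ (t - r) * 2 ^ r by rewrite -expnD subnK // ltnW.
have P : 0 < 2 ^ r by rewrite expn_gt0.
rewrite /branch E !divnMDl // oddD oddX /= orbF subn_eq0 leqNgt rt /=.
by rewrite -addnS eqn_add2l.
Qed.

Lemma branch_top t b b' : b < 2 ^ t -> b' < 2 ^ t -> branch t b (2 ^ t + b').
Proof.
move=> bt bt'; rewrite /branch; have -> : (2 ^ t + b') %/ 2 ^ t = 1.
  by rewrite -[X in X + b']mul1n divnMDl ?expn_gt0 // divn_small.
by rewrite divn_small.
Qed.

(* Of the two halves of a node of height r in the binary tree over the integers
   below 2 ^ t, the set S r meets at most one. *)
Lemma sum_hits t (S : nat -> nat -> bool) :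
  (forall r b b', r < t -> b < 2 ^ t -> b' < 2 ^ t ->
     S r b -> S r b' -> ~~ branch r b b') ->
  \sum_(0 <= b < 2 ^ t) 2 ^ (\sum_(0 <= r < t) S r b) <= 3 ^ t.
Proof.
elim: t S => [|t IH] S H; first by rewrite expn0 big_nat1 big_geq.
have ltS b : b < 2 ^ t -> b < 2 ^ t.+1 by rewrite expnS; lia.
have ltS' b : b < 2 ^ t -> 2 ^ t + b < 2 ^ t.+1 by rewrite expnS; lia.
have lo : \sum_(0 <= b < 2 ^ t) 2 ^ (\sum_(0 <= r < t) S r b) <= 3 ^ t.
  by apply: IH => r b b' rt bt bt'; apply: H; rewrite ?ltS // ltnW.
have hi : \sum_(0 <= b < 2 ^ t) 2 ^ (\sum_(0 <= r < t) S r (2 ^ t + b)) <= 3 ^ t.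
  apply: (IH (fun r b => S r (2 ^ t + b))) => r b b' rt bt bt' Sb Sb'.
  by rewrite -(branch_shift _ _ rt); apply: H; rewrite ?ltS' // ltnW.
have E : \sum_(0 <= b < 2 ^ t.+1) 2 ^ (\sum_(0 <= r < t.+1) S r b) =
  \sum_(0 <= b < 2 ^ t) 2 ^ (\sum_(0 <= r < t) S r b) * 2 ^ S t b +
  \sum_(0 <= b < 2 ^ t) 2 ^ (\sum_(0 <= r < t) S r (2 ^ t + b)) * 2 ^ S t (2 ^ t + b).
  rewrite (@big_cat_nat _ _ _ (2 ^ t)) //=; last by rewrite expnS; lia.
  congr (_ + _); first by apply: eq_bigr => b _; rewrite big_nat_recr //= expnD.
  rewrite -{1}(add0n (2 ^ t)) big_addn.
  have -> : 2 ^ t.+1 - 2 ^ t = 2 ^ t by rewrite expnS; lia.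
  by apply: eq_bigr => b _; rewrite addnC big_nat_recr //= expnD.
have le2 F (G : nat -> bool) : \sum_(0 <= b < 2 ^ t) F b <= 3 ^ t ->
    \sum_(0 <= b < 2 ^ t) F b * 2 ^ G b <= 2 * 3 ^ t.
  move=> FH; apply: leq_trans (leq_mul (leqnn 2) FH); rewrite big_distrr /=.
  by apply: leq_sum => b _; rewrite mulnC leq_mul2r; case: (G b); rewrite orbT.
have le1 F (G : nat -> bool) : (forall b, b < 2 ^ t -> ~~ G b) ->
    \sum_(0 <= b < 2 ^ t) F b <= 3 ^ t ->
    \sum_(0 <= b < 2 ^ t) F b * 2 ^ G b <= 3 ^ t.
  move=> HG FH; apply: leq_trans FH; rewrite big_nat [leqRHS]big_nat.
  by apply: leq_sum => b /andP[_ bt]; rewrite (negbTE (HG _ bt)) muln1.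
rewrite E expnS.
(* At the top level [S t] misses one half entirely, so the weights double on at most one half:
   [2 * 3 ^ t + 3 ^ t = 3 ^ t.+1]. *)
case: (pselect (exists2 b, b < 2 ^ t & S t b)) => [[b0 b0t Sb0]|nS].
  have := le2 _ (S t) lo; suff /le1/(_ hi) : forall b, b < 2 ^ t -> ~~ S t (2 ^ t + b) by lia.
  move=> b bt; apply/negP => Sb.
  by have := H t b0 (2 ^ t + b) (ltnSn t) (ltS _ b0t) (ltS' _ bt) Sb0 Sb; rewrite branch_top.
have := le2 _ (fun b => S t (2 ^ t + b)) hi.
suff /le1/(_ lo) : forall b, b < 2 ^ t -> ~~ S t b by lia.
by move=> b bt; apply/negP => Sb; apply: nS; exists b.
Qed.

Definition branch_free T (r : nat) (S : {set 'I_T}) : bool :=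
  [forall b in S, forall b' in S, ~~ branch r b b'].

Lemma branch_freeP T r (S : {set 'I_T}) :
  reflect {in S &, forall b b' : 'I_T, ~~ branch r b b'} (branch_free r S).
Proof.
apply: (iffP forall_inP) => H b; first by move=> b' bS b'S; exact: (forall_inP (H b bS)).
by move=> bS; apply/forall_inP => b' b'S; exact: H.
Qed.

Lemma branch_free0 T r : branch_free r (finset.set0 : {set 'I_T}).
Proof. by apply/branch_freeP => b b'; rewrite inE. Qed.

(* 11 ^ u is much smaller than 2 ^ (4 * u) = 16 ^ u. *)
Lemma card_many_hits u (S : 'I_(4 * u) -> {set 'I_(2 ^ (4 * u))}) :
  (forall r : 'I_(4 * u), branch_free r (S r)) ->
  #|[set b | 3 * u <= \sum_r (b \in S r)]| <= 11 ^ u.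
Proof.
move=> HS; set t := 4 * u in S HS *.
pose S' r b := if insub r is Some r' then
  if insub b is Some b' then (b' : 'I_(2 ^ t)) \in S r' else false else false.
have S'E (r : 'I_t) (b : 'I_(2 ^ t)) : S' r b = (b \in S r).
  by rewrite /S' !valK.
have /(@sum_hits t S') : forall r b b', r < t -> b < 2 ^ t -> b' < 2 ^ t ->
    S' r b -> S' r b' -> ~~ branch r b b'.
  move=> r b b' rt bt bt'.
  rewrite -[r]/(val (Ordinal rt)) -[b]/(val (Ordinal bt)) -[b']/(val (Ordinal bt')).
  by rewrite !S'E; exact: (branch_freeP _ _ (HS _)).
rewrite big_mkord.
under eq_bigr do rewrite big_mkord; under eq_bigr do under eq_bigr do rewrite S'E.
rewrite [3 ^ t]expnM => H.
(* Markov's inequality for the weight 2 to the number of hits: each counted [b] weighs at least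
   [8 ^ u], the total is at most [81 ^ u], and [81 <= 8 * 11]. *)
have : #|[set b | 3 * u <= \sum_r (b \in S r)]| * 8 ^ u <= 81 ^ u.
  apply: leq_trans H.
  rewrite -sum_nat_const [leqRHS](bigID (mem [set b | 3 * u <= \sum_r (b \in S r)])) /=.
  apply: leq_trans (leq_addr _ _); apply: leq_sum => b; rewrite inE => Hb.
  by rewrite -[8]/(2 ^ 3) -expnM leq_exp2l.
move=> {}H; rewrite -(leq_pmul2r (_ : 0 < 8 ^ u)) ?expn_gt0 //.
apply: leq_trans H _; rewrite -expnMn.
by case: (posnP u) => u0; [rewrite u0 | rewrite leq_exp2r].
Qed.

(** Double counting: a block outside [Z] is hit fewer than [3 * u] times, one in [Z] at most [4 * u]
    times, and [Z] has at most [11 ^ u] elements. *)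
Lemma sum_hits_le u (S : 'I_(4 * u) -> {set 'I_(2 ^ (4 * u))})
    (A : {set 'I_(2 ^ (4 * u))}) :
  (forall r : 'I_(4 * u), branch_free r (S r)) ->
  \sum_r #|A :&: S r| <= 3 * u * #|A| + u * 11 ^ u.
Proof.
move=> HS; set Z := [set b | 3 * u <= \sum_r (b \in S r)].
have -> : \sum_r #|A :&: S r| = \sum_(b in A) \sum_r (b \in S r).
  rewrite exchange_big /=; apply: eq_bigr => r _.
  rewrite -sum1_card big_mkcond [RHS]big_mkcond /=; apply: eq_bigr => b _.
  by rewrite inE; case: (b \in A); case: (b \in S r).
apply: leq_trans (_ : \sum_(b in A) (3 * u + u * (b \in Z)) <= _).
  apply: leq_sum => b _; rewrite inE.
  case: (leqP (3 * u)) => Hb /=; last by rewrite muln0 addn0 ltnW.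
  have : \sum_(r : 'I_(4 * u)) (b \in S r) <= \sum_(r : 'I_(4 * u)) 1.
    by apply: leq_sum => r _; case: (b \in S r).
  by rewrite sum1_card card_ord muln1 => /leq_trans; apply; rewrite [leqLHS]mulSn addnC.
rewrite big_split /= sum_nat_const -big_distrr /= mulnC leq_add2l leq_mul2l.
apply/orP; right; apply: leq_trans (card_many_hits HS).
rewrite -/Z -[leqRHS]sum1_card big_mkcond [leqRHS]big_mkcond /=.
by apply: leq_sum => b _; case: (b \in A); case: (b \in Z).
Qed.

(** * The permutation carried by a strip *)

Section Gadget.
Variables (T B : nat).

Definition gadget_pos (z : 'I_T * 'I_B) : nat := z.1 * B + z.2.

(* The order reversing the positions, except that the two halves of every
   block of length 2L, L = 2 ^ r * B, are exchanged. *)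
Definition gadget_rev (r : nat) (z : 'I_T * 'I_B) : nat :=
  T * B + 2 * (2 ^ r * B) * odd (gadget_pos z %/ (2 ^ r * B)) - gadget_pos z.

Lemma gadget_pos_inj : injective gadget_pos.
Proof.
move=> [b g] [b' g'] /eqP e; have Bgt0 : 0 < B by case: (B) (g) => [[]|].
have := ltn_lex b b' (ltn_ord g) (ltn_ord g').
have := ltn_lex b' b (ltn_ord g') (ltn_ord g).
rewrite -/(gadget_pos (b, g)) -/(gadget_pos (b', g')) (eqP e) ltnn.
case: (ltngtP b b') => //= /val_inj ->.
by case: (ltngtP g g') => //= /val_inj ->.
Qed.

(** This makes the truncated subtraction in [gadget_rev] exact. *)
Lemma gadget_pos_lt z : gadget_pos z < T * B.
Proof.
by case: z => -[b bT] [g gB]; rewrite /gadget_pos /=; nia.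
Qed.

Lemma gadget_pos_div r z : gadget_pos z %/ (2 ^ r * B) = z.1 %/ 2 ^ r.
Proof.
have Bgt0 : 0 < B by case: (B) z => [[_ []]|].
by rewrite mulnC divnMA /gadget_pos divnMDl // (divn_small (ltn_ord _)) addn0.
Qed.

(** Equal values at blocks of different parity would put the positions exactly [2 * L] apart, which
    preserves the parity of the block. *)
Lemma gadget_rev_inj r : injective (gadget_rev r).
Proof.
move=> z z'; rewrite /gadget_rev.
have Bgt0 : 0 < B by case: (B) z => [[_ []]|].
set L := 2 ^ r * B; have Lgt0 : 0 < L by rewrite muln_gt0 expn_gt0.
have := gadget_pos_lt z; have := gadget_pos_lt z'.
set a := gadget_pos z; set a' := gadget_pos z' => lt' lt e.
suff : a = a' by exact: gadget_pos_inj.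
have [oE|] := eqVneq (odd (a %/ L)) (odd (a' %/ L)); first by move: e; rewrite oE; lia.
move: e; case E : (odd (a %/ L)); case E' : (odd (a' %/ L)) => // e _.
  have aE : a = 2 * L + a' by lia.
  by move: E; rewrite aE divnMDl // oddD E'.
have aE : a' = 2 * L + a by lia.
by move: E'; rewrite aE divnMDl // oddD E.
Qed.

(** The exchange lifts the block of [z'] above that of [z]. Positions in between stay in these two
    blocks, each of which is reversed: they land below [z] or above [z']. *)
Lemma gadget_hasse r (z z' : 'I_T * 'I_B) :
  branch r z.1 z'.1 -> hasse gadget_pos (gadget_rev r) z z'.
Proof.
have Bgt0 : 0 < B by case: (B) z => [[_ []]|].
move=> /andP[]; rewrite -!gadget_pos_div.
have := gadget_pos_lt z; have := gadget_pos_lt z'; rewrite /gadget_rev.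
set L := 2 ^ r * B; have Lgt0 : 0 < L by rewrite muln_gt0 expn_gt0.
set a := gadget_pos z; set a' := gadget_pos z' => lt' lt ev /eqP E'.
have := divn_eq a L; have := ltn_pmod a Lgt0.
have := divn_eq a' L; have := ltn_pmod a' Lgt0; rewrite -E' mulSn => m1 d1 m2 d2.
apply/hasseP; rewrite -E' /= ev (negbTE ev); split; [lia|lia|].
move=> w; have := gadget_pos_lt w; rewrite -/L.
set c := gadget_pos w => ltc ac ca'.
have := divn_eq c L; have := ltn_pmod c Lgt0 => m3 d3.
have [e|e] : c %/ L = a %/ L \/ c %/ L = (a %/ L).+1.
- have : a %/ L <= c %/ L by exact: leq_div2r (ltnW ac).
  have : c %/ L <= a' %/ L by exact: leq_div2r (ltnW ca').
  by rewrite -E'; lia.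
- by rewrite e (negbTE ev); lia.
- by rewrite e /= ev; lia.
Qed.

End Gadget.

(** * Random levels and the union bound *)

(** Here [A] stands for the blocks whose container holds a given point; this is the most that an
    independent set can keep of them. *)
Definition best T (r : nat) (A : {set 'I_T}) : nat :=
  \max_(S : {set 'I_T} | branch_free r S) #|A :&: S|.

Lemma best_le T r (A : {set 'I_T}) : best r A <= #|A|.
Proof. by apply/bigmax_leqP => S _; rewrite subset_leq_card // finset.subsetIl. Qed.

(** The family in [sum_hits_le] is arbitrary, so an extremal set may be taken at each level
    separately. *)
Lemma sum_best u (A : {set 'I_(2 ^ (4 * u))}) :
  \sum_(r < 4 * u) best r A <= 3 * u * #|A| + u * 11 ^ u.
Proof.
have H (r : 'I_(4 * u)) : exists S : {set 'I_(2 ^ (4 * u))},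
    branch_free r S /\ best r A = #|A :&: S|.
  have [|S SP SE] := @eq_bigmax_cond _ (fun S : {set 'I_(2 ^ (4 * u))} => branch_free r S)
    (fun S => #|A :&: S|); last by exists S; split=> //; exact: SE.
  by apply/card_gt0P; exists finset.set0; exact: branch_free0.
have [S SH] := choice H; rewrite (eq_bigr (fun r => #|A :&: S r|)) => [|r _].
  by apply: sum_hits_le => r; case: (SH r).
by case: (SH r).
Qed.

Local Open Scope ring_scope.

Section Levels.
Variable R : realType.

(** Because [expR d >= 1 + d] and [(1 - d / 2) * (1 + d) = 1 + d * (1 - d) / 2 >= 1]. *)
Lemma expRN_le (d : R) : 0 <= d <= 1 -> expR (- d) <= 1 - d / 2.
Proof.
move=> /andP[d0 d1]; rewrite expRN.
have H : 1 + d <= expR d := expR_ge1Dx d.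
rewrite -[leLHS]mul1r ler_pdivrMr ?expR_gt0 //.
apply: (@le_trans _ _ ((1 - d / 2) * (1 + d))); first by nra.
by rewrite ler_wpM2l // subr_ge0; lra.
Qed.

(** A moment generating function for a uniform level. By [sum_best] the mean relative loss is at
    least [(#|A| - 11 ^ u) / (4 * T)]; [expRN_le] retains half of it, whence 7/8. *)
Lemma mgf_best u (A : {set 'I_(2 ^ (4 * u))}) : 
  \sum_(r < 4 * u) expR ((best r A)%:R / (2 ^ (4 * u))%:R) <=
  (4 * u)%:R * expR (7 / 8 * (#|A|%:R / (2 ^ (4 * u))%:R)
                     + (11 ^ u)%:R / (8 * (2 ^ (4 * u))%:R)) :> R.
Proof.
set T : R := (2 ^ (4 * u))%:R; have T0 : 0 < T by rewrite ltr0n expn_gt0.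
have AT : #|A|%:R <= T by rewrite ler_nat -[leqRHS]card_ord max_card.
have step (r : 'I_(4 * u)) : expR ((best r A)%:R / T) <=
    expR (#|A|%:R / T) * (1 - (#|A|%:R - (best r A)%:R) / T / 2).
  have -> : (best r A)%:R / T = #|A|%:R / T + - ((#|A|%:R - (best r A)%:R) / T).
    by field; rewrite gt_eqF.
  rewrite expRD ler_wpM2l ?expR_ge0 // expRN_le //.
  have bA : (best r A)%:R <= #|A|%:R :> R by rewrite ler_nat best_le.
  rewrite divr_ge0 ?subr_ge0 ?(ltW T0) //= ler_pdivrMr // mul1r.
  by apply: le_trans AT; rewrite gerBl.
apply: le_trans (ler_sum _ (fun r _ => step r)) _.
rewrite -mulr_sumr.
have -> : \sum_(r < 4 * u) (1 - (#|A|%:R - (best r A)%:R) / T / 2) =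
    (4 * u)%:R - ((4 * u)%:R * #|A|%:R - (\sum_(r < 4 * u) best r A)%:R) / T / 2 :> R.
  rewrite sumrB -!mulr_suml sumrB !sumr_const card_ord -natr_sum.
  by rewrite -(mulr_natl #|A|%:R).
have HB : (\sum_(r < 4 * u) best r A)%:R <= 3 * u%:R * #|A|%:R + u%:R * (11 ^ u)%:R :> R.
  by rewrite -!natrM -natrD ler_nat; exact: sum_best.
pose y : R := (#|A|%:R - (11 ^ u)%:R) / (8 * T).
apply: (@le_trans _ _ (expR (#|A|%:R / T) * ((4 * u)%:R * (1 - y)))).
  rewrite ler_wpM2l ?expR_ge0 // -subr_ge0.
  have -> : (4 * u)%:R * (1 - y) - ((4 * u)%:R -
      ((4 * u)%:R * #|A|%:R - (\sum_(r < 4 * u) best r A)%:R) / T / 2) =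
    (3 * u%:R * #|A|%:R + u%:R * (11 ^ u)%:R - (\sum_(r < 4 * u) best r A)%:R) / T / 2.
    by rewrite /y natrM; field; rewrite gt_eqF.
  by rewrite !divr_ge0 ?subr_ge0 // ltW.
rewrite mulrCA ler_wpM2l //.
have -> : 7 / 8 * (#|A|%:R / T) + (11 ^ u)%:R / (8 * T) = #|A|%:R / T + - y.
  by rewrite /y; field; rewrite gt_eqF.
by rewrite expRD ler_wpM2l ?expR_ge0 // expR_ge1Dx.
Qed.

(** First moment method: if each [r] were bad for some [f], the sum of [F f r] would be at least the
    number of choices of [r], while it is at most that number times [expR (m / 64 - m / 32)]. *)
Lemma exists_levels (V J : finType) (C : J -> {set V}) (u D : nat) (m : R) :
  (0 < u)%N -> 0 < m -> (#|J| <= 2 ^ D)%N -> (forall j, #|C j|%:R <= m) ->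
  64 * (D * 2 ^ (4 * u))%:R <= m ->
  4 * (#|V| * 11 ^ u)%:R <= m * (2 ^ (4 * u))%:R ->
  exists r : {ffun V -> 'I_(4 * u)},
  forall (f : {ffun 'I_(2 ^ (4 * u)) -> J}) (S : V -> {set 'I_(2 ^ (4 * u))}),
    (forall v, branch_free (r v) (S v)) ->
    (\sum_b #|[set v in C (f b) | b \in S v]|)%:R <= 15 / 16 * m * (2 ^ (4 * u))%:R.
Proof.
move=> u0 m0 JD Cm Dm Vm; set T := (2 ^ (4 * u))%N; set t := (4 * u)%N.
have T0 : 0 < T%:R :> R by rewrite ltr0n expn_gt0.
pose A (f : {ffun 'I_T -> J}) v := [set b | v \in C (f b)].
pose bad f (r : {ffun V -> 'I_t}) : bool :=
  15 / 16 * m * T%:R < (\sum_v best (r v) (A f v))%:R.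
have [r Hr] : exists r, forall f, ~~ bad f r.
  apply: contrapT => Hno.
  have ex r : exists f, bad f r.
    by apply: contrapT => Hf; apply: Hno; exists r => f; apply/negP => Hb; apply: Hf; exists f.
  (* Exponential Markov weight, at least 1 on bad pairs. *)
  pose F f (r : {ffun V -> 'I_t}) : R :=
    expR (\sum_v (best (r v) (A f v))%:R / T%:R) * expR (- (15 / 16 * m)).
  have F0 f r : 0 <= F f r by rewrite mulr_ge0 ?expR_ge0.
  have sumA f : \sum_v #|A f v|%:R / T%:R <= m :> R.
    rewrite -mulr_suml ler_pdivrMr // -natr_sum.
    have -> : (\sum_v #|A f v| = \sum_b #|C (f b)|)%N.
      under eq_bigr do rewrite -sum1_card big_mkcond /=.
      under [RHS]eq_bigr do rewrite -sum1_card big_mkcond /=.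
      rewrite exchange_big /=; apply: eq_bigr => b _; apply: eq_bigr => v _.
      by rewrite inE.
    rewrite natr_sum; apply: le_trans (ler_sum _ (fun b _ => Cm (f b))) _.
    by rewrite sumr_const card_ord mulr_natr.
  have sumF f : \sum_r F f r <= (t ^ #|V|)%:R * expR (- (m / 32)).
    rewrite /F -mulr_suml.
    under eq_bigr do rewrite expR_sum.
    (* The levels of different points are independent, so the sum over [r] factors. *)
    rewrite -(bigA_distr_bigA (fun v (r : 'I_t) => expR ((best r (A f v))%:R / T%:R))).
    have : \prod_v \sum_(r < t) expR ((best r (A f v))%:R / T%:R) <=
        \prod_v (t%:R * expR (7 / 8 * (#|A f v|%:R / T%:R) + (11 ^ u)%:R / (8 * T%:R))) :> R.
      apply: ler_prod => v _; rewrite mgf_best andbT.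
      by apply: sumr_ge0 => r _; exact: expR_ge0.
    rewrite big_split /= -expR_sum prodr_const big_split /= -mulr_sumr sumr_const.
    rewrite -natrX => /(ler_wpM2r (expR_ge0 (- (15 / 16 * m)))) /le_trans; apply.
    rewrite -[leLHS]mulrA ler_wpM2l // -expRD ler_expR.
    (* The exponent is then at most [7/8 * m + m/32 - 15/16 * m = - m/32]. *)
    have : (11 ^ u)%:R / (8 * T%:R) *+ #|V| <= m / 32.
      rewrite -mulr_natl mulrA -natrM ler_pdivrMr ?mulr_gt0 //.
      have -> : m / 32 * (8 * T%:R) = (m * T%:R) / 4 by field.
      by rewrite ler_pdivlMr // mulrC.
    by have := sumA f; lra.
  have Hlow : (t ^ #|V|)%:R <= \sum_f \sum_r F f r.
    rewrite exchange_big /=.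
    have -> : (t ^ #|V|)%:R = \sum_(r : {ffun V -> 'I_t}) (1 : R).
      by rewrite sumr_const card_ffun card_ord.
    apply: ler_sum => r _; have [f bf] := ex r.
    rewrite (bigD1 f) //= -[1]addr0 lerD //; last by apply: sumr_ge0 => f' _.
    rewrite /F -expRD; apply: le_trans (expR_ge1Dx _).
    rewrite lerDl subr_ge0 -mulr_suml ler_pdivlMr // -natr_sum.
    exact: ltW bf.
  have cardf : #|{ffun 'I_T -> J}|%:R <= expR (m / 64) :> R.
    rewrite card_ffun card_ord; apply: (@le_trans _ _ (2 ^+ (D * T))).
      by rewrite -natrX ler_nat expnM leq_exp2r ?expn_gt0.
    apply: (@le_trans _ _ (expR 1 ^+ (D * T))).
      by rewrite lerXn2r ?nnegrE ?expR_ge0 // (le_trans _ (expR_ge1Dx 1)).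
    by rewrite -expRM_natl mulr1 ler_expR ler_pdivlMr // mulrC.
  have : \sum_f \sum_r F f r <= (t ^ #|V|)%:R * (expR (m / 64) * expR (- (m / 32))).
    apply: le_trans (ler_sum _ (fun f _ => sumF f)) _.
    rewrite sumr_const -[leLHS]mulr_natl [leLHS]mulrCA ler_wpM2l // ler_wpM2r ?expR_ge0 //.
  move=> /(le_trans Hlow); rewrite -expRD.
  have tV : 0 < (t ^ #|V|)%:R :> R by rewrite ltr0n expn_gt0 muln_gt0 u0.
  rewrite -[leLHS]mulr1 ler_pM2l // leNgt expR_lt1; apply/negP; rewrite negbK; lra.
exists r => f S HS; have := Hr f; rewrite /bad -leNgt; apply: le_trans.
rewrite ler_nat.
have -> : (\sum_b #|[set v in C (f b) | b \in S v]| = \sum_v #|A f v :&: S v|)%N.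
  under eq_bigr do rewrite -sum1_card big_mkcond /=.
  under [RHS]eq_bigr do rewrite -sum1_card big_mkcond /=.
  rewrite exchange_big /=; apply: eq_bigr => v _; apply: eq_bigr => b _.
  by rewrite !inE.
apply: leq_sum => v _.
exact: (@leq_bigmax_cond _ (fun S => branch_free (r v) S) (fun S => #|A f v :&: S|)).
Qed.

End Levels.

(** * Containers and one round of the construction *)

(** Coordinates are natural numbers because only their order matters; containers need not be
    independent. *)
Definition contained (R : realType) (N D : nat) (m : R) : Prop :=
  exists (V J : finType) (x y : V -> nat) (C : J -> {set V}),
    [/\ injective x, injective y, #|V| = N, (#|J| <= 2 ^ D)%N &
        (forall j, #|C j|%:R <= m) /\
        (forall I, hasse_free x y I -> exists j, I \subset C j)].

Lemma contained_point (R : realType) : contained 1 0 (1 : R).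
Proof.
exists unit, unit, (fun=> 0%N), (fun=> 0%N), (fun=> [set: unit]).
split; rewrite ?card_unit //; try by move=> [] [].
split=> [_|I _]; first by rewrite cardsT card_unit.
by exists tt; rewrite finset.subsetT.
Qed.

Lemma contained_step (R : realType) (N D u B : nat) (m : R) :
  (0 < u)%N -> 0 < m -> contained N D m ->
  64 * (D * 2 ^ (4 * u))%:R <= m -> 4 * (N * 11 ^ u)%:R <= m * (2 ^ (4 * u))%:R ->
  contained (N * (2 ^ (4 * u) * B)) (D * (2 ^ (4 * u) * B) + 2 ^ (4 * u) * N)
    (15 / 16 * m * (2 ^ (4 * u) * B)%:R).
Proof.
move=> u0 m0 [V [J [x [y [C [xI yI VN JD [Cm Cx]]]]]]] Dm; rewrite -VN => Vm.
have [r Hr] := exists_levels u0 m0 JD Cm Dm Vm.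
set T := (2 ^ (4 * u))%N in r Hr *.
pose x' := lex_x x (@gadget_pos T B).
pose y' := lex_y y (fun v => @gadget_rev T B (r v)).
(* The index set runs over all families of block sets; those that branch are emptied so that the
   size bound holds for every index. *)
pose S' v (S : {set 'I_T}) := if branch_free (r v) S then S else finset.set0.
pose C' (j : {ffun 'I_T * 'I_B -> J} * {ffun V -> {set 'I_T}}) :=
  [set z : V * ('I_T * 'I_B) | (z.1 \in C (j.1 z.2)) && (z.2.1 \in S' z.1 (j.2 z.1))].
exists (V * ('I_T * 'I_B))%type, ({ffun 'I_T * 'I_B -> J} * {ffun V -> {set 'I_T}})%type.
exists x', y', C'; split.
- exact: lex_x_inj xI (@gadget_pos_inj T B).
- by apply: lex_y_inj yI _ => v; exact: gadget_rev_inj.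
- by rewrite !card_prod !card_ord.
- have cS : #|{set 'I_T}| = (2 ^ T)%N.
    by rewrite -cardsT -powersetT card_powerset cardsT card_ord.
  rewrite card_prod !card_ffun card_prod !card_ord cS.
  rewrite expnD leq_mul //; last by rewrite -expnM.
  by rewrite [leqRHS]expnM; case: (posnP (T * B)) => [->|TB] //; rewrite leq_exp2r.
- split=> [[f S]|I /hasse_freeP HI].
    (* For fixed [g] the copies [(b, g)] form one [T]-tuple of old containers; the same levels [r]
       serve all [B] tuples. *)
    have -> : #|C' (f, S)| = (\sum_(g : 'I_B) \sum_(b : 'I_T)
        #|[set v in C (f (b, g)) | b \in S' v (S v)]|)%N.
      have -> : #|C' (f, S)| = (\sum_z \sum_v ((v, z) \in C' (f, S)))%N.
        rewrite exchange_big pair_bigA -sum1_card big_mkcond /=.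
        by apply: eq_bigr => -[v z] _; case: (_ \in _).
      rewrite [RHS]exchange_big [RHS]pair_bigA /=; apply: eq_bigr => -[b g] _.
      rewrite -sum1_card [RHS]big_mkcond /=; apply: eq_bigr => v _.
      by rewrite !inE; case: (_ && _).
    have -> : 15 / 16 * m * (T * B)%:R = \sum_(g < B) 15 / 16 * m * T%:R.
      by rewrite sumr_const card_ord natrM mulrA mulr_natr.
    rewrite natr_sum; apply: ler_sum => g _.
    have := Hr [ffun b => f (b, g)] (fun v => S' v (S v)); under eq_bigr do rewrite ffunE.
    by apply=> v; rewrite /S'; case: ifP => // _; exact: branch_free0.
  have HC a : exists j, [set v | (v, a) \in I] \subset C j.
    apply: Cx; apply/hasse_freeP => v w; rewrite !inE => vI wI.
    by apply: contra (HI _ _ vI wI); exact: hasse_lex1.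
  have [f Hf] := choice HC.
  exists ([ffun a => f a], [ffun v => [set b | [exists g, (v, (b, g)) \in I]]]).
  apply/fintype.subsetP => -[v [b g]] zI; rewrite inE /= !ffunE.
  apply/andP; split; first by apply: (fintype.subsetP (Hf _)); rewrite inE.
  rewrite /S' ifT; first by rewrite inE; apply/existsP; exists g.
  apply/branch_freeP => c c'; rewrite !inE => /existsP[h hI] /existsP[h' hI'].
  apply: contra (HI _ _ hI hI') => br; apply: hasse_lex2 => //.
  exact: gadget_hasse.
Qed.

(** * Iterating the rounds *)

Section Iteration.
Variables (R : realType) (u : nat).
Hypothesis u6 : (6 <= u)%N.

Let T := (2 ^ (4 * u))%N.
Let k := (T * 64 ^ u)%N.

Let TE : T = (16 ^ u)%N. Proof. by rewrite /T expnM. Qed.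
Let T0 : (0 < T)%N. Proof. by rewrite expn_gt0. Qed.
Let k0 : (0 < k)%N. Proof. by rewrite muln_gt0 T0 expn_gt0. Qed.

Let pow15 i : (i <= u)%N -> (15 / 16) ^+ u <= (15 / 16) ^+ i :> R.
Proof. by move=> iu; apply: ler_wiXn2l => //; lra. Qed.

Let pow11 : 4 * 11 ^+ u <= (15 / 16) ^+ u * 16 ^+ u :> R.
Proof.
rewrite -exprMn divfK ?pnatr_eq0 // -(subnKC u6) !exprD mulrA.
apply: ler_pM; rewrite ?mulr_ge0 ?exprn_ge0 //; first by rewrite !exprS !expr0; lra.
by rewrite lerXn2r ?nnegrE //; lra.
Qed.

(** After cancelling [16 ^ u] and using [15 / 16 * 4 >= 3], it remains that [64 * u <= 3 ^ u], which
    holds from 6 on. *)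
Let pow64 : 64 * u%:R * 16 ^+ u <= (15 / 16) ^+ u * 64 ^+ u :> R.
Proof.
have -> : 64 ^+ u = 4 ^+ u * 16 ^+ u :> R by rewrite -exprMn; congr (_ ^+ _); lra.
rewrite mulrA ler_wpM2r ?exprn_ge0 // -exprMn.
apply: (@le_trans _ _ (3 ^+ u)); last by rewrite lerXn2r ?nnegrE //; lra.
rewrite -natrX -natrM ler_nat -(subnKC u6); elim: (u - 6)%N => [//|v IH].
by rewrite addnS expnS; lia.
Qed.

Let cond_entropy i : (i < u)%N ->
  64 * ((i * T * k ^ i.-1) * 2 ^ (4 * u))%:R <= (15 / 16) ^+ i * (k ^ i)%:R :> R.
Proof.
case: i => [|i] iu; first by rewrite !mul0n mulr0 mulr_ge0.
rewrite -/T /= expnS.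
have -> : 64 * (i.+1 * T * k ^ i * T)%:R = 64 * i.+1%:R * 16 ^+ u * (T * k ^ i)%:R :> R.
  by rewrite -natrX -TE !natrM; ring.
have -> : (15 / 16) ^+ i.+1 * (k * k ^ i)%:R =
    (15 / 16) ^+ i.+1 * 64 ^+ u * (T * k ^ i)%:R :> R.
  by rewrite -natrX /k !natrM; ring.
rewrite ler_wpM2r //.
apply: (@le_trans _ _ (64 * u%:R * 16 ^+ u)).
  by rewrite ler_wpM2r ?exprn_ge0 // ler_wpM2l // ler_nat ltnW.
by apply: le_trans pow64 _; rewrite ler_wpM2r ?exprn_ge0 // pow15 // ltnW.
Qed.

Let cond_error i : (i < u)%N ->
  4 * (k ^ i * 11 ^ u)%:R <= (15 / 16) ^+ i * (k ^ i)%:R * (2 ^ (4 * u))%:R :> R.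
Proof.
move=> iu; rewrite -/T TE natrM mulrCA -mulrA [leRHS]mulrCA ler_wpM2l // !natrX.
by apply: le_trans pow11 _; rewrite ler_wpM2r ?exprn_ge0 // pow15 // ltnW.
Qed.

(** The entropy per point is [i / 64 ^ u], small against the container density [(15 / 16) ^ i]. At
    [i = 0] the factor [i] makes the truncated [i.-1] harmless. *)
Lemma contained_iter i : (i < u)%N ->
  contained (k ^ i) (i * T * k ^ i.-1) ((15 / 16) ^+ i * (k ^ i)%:R : R).
Proof.
elim: i => [|i IH] iu.
  by rewrite !mul0n !expn0 expr0 mulr1; exact: contained_point.
have iu' := ltnW iu.
have m0 : 0 < (15 / 16) ^+ i * (k ^ i)%:R :> R.
  by rewrite mulr_gt0 ?exprn_gt0 ?ltr0n ?expn_gt0 ?k0 //; lra.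
have u0 : (0 < u)%N by apply: leq_trans u6.
have := contained_step (64 ^ u) u0 m0 (IH iu') (cond_entropy iu') (cond_error iu').
rewrite -/T -/k -expnSr /=.
have -> : (i * T * k ^ i.-1 * k + T * k ^ i = i.+1 * T * k ^ i)%N.
  case: (i) => [|j] /=; first by rewrite !mul0n add0n mul1n.
  by rewrite -mulnA -expnSr; lia.
by rewrite exprS -!mulrA -natrM -expnSr.
Qed.

(** The number of copies per block is free in a round: the last one takes [(n %/ q).+1], which lands
    on a multiple of [q] between [n] and [2 * n]. *)
Lemma contained_above n : (k ^ u <= n)%N ->
  exists N D, [/\ (n <= N)%N, (N <= 2 * n)%N & contained N D ((15 / 16) ^+ u * N%:R : R)].
Proof.
have u0 : (0 < u)%N by apply: leq_trans u6.
have iu : (u.-1 < u)%N by rewrite prednK.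
move=> kn; set q := (k ^ u.-1 * T)%N.
have q0 : (0 < q)%N by rewrite muln_gt0 expn_gt0 k0.
have qn : (q <= n)%N.
  apply: leq_trans kn; rewrite -[X in (_ <= _ ^ X)%N](prednK u0) expnSr leq_mul //.
  by rewrite leq_pmulr // expn_gt0.
have m0 : 0 < (15 / 16) ^+ u.-1 * (k ^ u.-1)%:R :> R.
  by rewrite mulr_gt0 ?exprn_gt0 ?ltr0n ?expn_gt0 ?k0 //; lra.
have := contained_step (n %/ q).+1 u0 m0 (contained_iter iu) (cond_entropy iu) (cond_error iu).
rewrite -/T; set D := (_ + _)%N => H.
exists (q * (n %/ q).+1)%N, D; split.
- by rewrite mulnC ltnW // ltn_ceil.
- by rewrite mulnS mulnC mul2n -addnn leq_add // leq_trunc_div.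
- move: H; rewrite mulnA -/q; congr (contained _ _ _).
  by rewrite -[X in _ = _ ^+ X * _](prednK u0) exprS -!mulrA -natrM mulnA.
Qed.

End Iteration.

(** * From posets to box-Delaunay graphs *)

Lemma independence_number_attained (G : sgraph) :
  exists2 S : {set G}, independent S & independence_number G = #|S|.
Proof.
have [|S SP SE] := @eq_bigmax_cond _ (fun S : {set G} => independent S) (fun S => #|S|).
  by apply/card_gt0P; exists finset.set0; apply/forall_inP => x; rewrite inE.
by exists S; last exact: SE.
Qed.

Lemma card_le_chromatic_independence (G : sgraph) :
  (#|G| <= chromatic_number G * independence_number G)%N.
Proof.
rewrite /chromatic_number; case: ex_minnP => k /existsP[f /forallP Hf] _.
rewrite -sum1_card (partition_big f xpredT) //=.
rewrite -[k in leqRHS]card_ord -sum_nat_const; apply: leq_sum => i _.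
rewrite sum1dep_card.
apply: (@leq_bigmax_cond _ (fun S : {set G} => independent S) (fun S => #|S|)).
apply/forall_inP => x; rewrite inE => /eqP fx; apply/forall_inP => y; rewrite inE => /eqP fy.
by apply/negP => xy; have := forallP (Hf x) y; rewrite xy fx fy eqxx.
Qed.

(** The box spanned by a cover holds only its two corners, injectivity excluding other points on the
    sides. Deleting points keeps such boxes empty, so any [n] points of [V] serve. *)
Lemma box_delaunay_realize (R : realType) (V : finType) (x y : V -> nat) (n : nat) (a : R) :
  injective x -> injective y -> (n <= #|V|)%N ->
  (forall I, hasse_free x y I -> #|I|%:R <= a) ->
  exists P : {fset R * R}, #|` P|%fset = n /\
    (independence_number (box_delaunay P))%:R <= a.
Proof.
move=> xI yI nV Ha; pose pt v : R * R := ((x v)%:R, (y v)%:R).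
have ptI : injective pt by move=> v w [/eqP]; rewrite eqr_nat => /eqP /xI.
pose P : {fset R * R} := [fset z in [seq pt v | v <- take n (enum V)]]%fset.
exists P; split.
  rewrite card_fseq undup_id ?size_map ?size_takel -?cardE //.
  by rewrite map_inj_uniq // take_uniq // enum_uniq.
have ex z : z \in P -> exists v, z = pt v.
  by rewrite in_fset /= => /mapP[v _ ->]; exists v.
have [g gE] := choice (fun z : P => ex (val z) (valP z)).
have gI : injective g by move=> z w e; apply: val_inj; rewrite !gE e.
have [S SP ->] := independence_number_attained (box_delaunay P).
rewrite -(card_imset _ gI); apply: Ha; apply/hasse_freeP.
move=> _ _ /imsetP[z zS ->] /imsetP[w wS ->]; apply/negP => /hasseP[xzw yzw H].
have /negP := forall_inP (forall_inP SP z zS) w wS; apply.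
apply/asboolP; split; first by move=> e; rewrite e ltnn in xzw.
exists (pt (g z)), (pt (g w)); rewrite !gE.
apply/seteqP; split=> [q /= [qP]|q /=].
  have [v ->] := ex _ qP; rewrite /box /= !in_itv /= !ler_nat.
  move=> [/andP[h1 h2] /andP[h3 h4]].
  case: (ltngtP (x (g z)) (x v)) h1 => // [h1 _|/xI -> _]; last by left.
  case: (ltngtP (x v) (x (g w))) h2 => // [h2 _|/xI -> _]; last by right.
  case: (ltngtP (y (g z)) (y v)) h3 => // [h3 _|/yI -> _]; last by left.
  case: (ltngtP (y v) (y (g w))) h4 => // [h4 _|/yI -> _]; last by right.
  by case: (H v).
case=> ->; rewrite -gE; (split; first exact: valP); rewrite gE /box /= !in_itv /= !ler_nat.
  by rewrite !leqnn (ltnW xzw) (ltnW yzw).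
by rewrite !leqnn (ltnW xzw) (ltnW yzw).
Qed.

(** * Choice of the parameters and the final bounds *)

Lemma square_exponent_cofinal (e u0 : nat) : (0 < e)%N -> exists n0, forall n, (n0 <= n)%N ->
  exists u, [/\ (u0 <= u)%N, (2 ^ (e * u ^ 2) <= n)%N & (n < 2 ^ (e * u.+1 ^ 2))%N].
Proof.
move=> e0; exists (2 ^ (e * u0 ^ 2))%N => n n0n.
have ubP u : (2 ^ (e * u ^ 2) <= n)%N -> (u <= n)%N.
  move=> H; apply: leq_trans (ltnW (ltn_expl u (ltnSn 1))) _; apply: leq_trans H.
  by rewrite leq_exp2l // -mulnn; nia.
have [u Hu umax] := ex_maxnP (ex_intro _ u0 n0n) ubP.
exists u; split=> //; first exact: umax.
by rewrite ltnNge; apply/negP => /umax; rewrite ltnn.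
Qed.

Section Bounds.
Variable R : realType.

Lemma expRN_le_powR2 (z : R) : 0 <= z -> expR (- z) <= 2 `^ (- z).
Proof.
move=> z0; rewrite /powR ifF; last by apply/negbTE; rewrite pnatr_eq0.
rewrite ler_expR mulNr lerN2 ler_piMr // -ler_expR lnK ?posrE //.
by apply: le_trans (expR_ge1Dx 1); lra.
Qed.

Lemma sqrt_ln_le (n : nat) (b : R) : 0 <= b -> n%:R <= expR (b ^+ 2) ->
  Num.sqrt (ln n%:R) <= b.
Proof.
move=> b0 nb; rewrite -[leRHS](ger0_norm b0) -sqrtr_sqr ler_wsqrtr //.
case: n nb => [|n] nb; first by rewrite ln0 // exprn_ge0.
by rewrite -ler_expR lnK // posrE ltr0n.
Qed.

Lemma independence_bound : exists c : R, 0 < c /\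
  forall n : nat, (0 < n)%N -> exists P : {fset R * R}, #|` P|%fset = n /\
    (independence_number (box_delaunay P))%:R <= n%:R * 2 `^ (- c * Num.sqrt (ln n%:R)) :> R.
Proof.
have [n0 Hn0] := square_exponent_cofinal 32 (isT : 0 < 10)%N.
(* The factor 1/256 serves large [n]; the square of [n0.+1] makes the bound nearly trivial below
   [n0]. *)
pose c : R := (256 * (n0.+1)%:R ^+ 2)^-1.
have d1 : 1 <= (n0.+1)%:R :> R by rewrite ler1n.
have c0 : 0 < c by rewrite invr_gt0 mulr_gt0 ?exprn_gt0 // ltr0n.
have c1 : c * (256 * (n0.+1)%:R ^+ 2) = 1 by rewrite mulVf // gt_eqF // -invr_gt0.
exists c; split=> // n n1.
have s0 : 0 <= Num.sqrt (ln n%:R) :> R by exact: sqrtr_ge0.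
have pw : expR (- (c * Num.sqrt (ln n%:R))) <= 2 `^ (- c * Num.sqrt (ln n%:R)) :> R.
  by rewrite mulNr expRN_le_powR2 // mulr_ge0 // ltW.
case: (leqP n0 n) => [/Hn0[u [u32 un nu]]|nn0].
  have u6 : (6 <= u)%N by apply: leq_trans u32.
  have kE v : ((2 ^ (4 * v) * 64 ^ v) ^ v = 2 ^ (10 * v ^ 2))%N.
    by rewrite -[64%N]/(2 ^ 6)%N -expnM -expnD -expnM; congr (_ ^ _)%N; lia.
  rewrite -kE in un.
  have [N [D [nN N2n [V [J [x [y [C [xI yI VN _ [Cm Cx]]]]]]]]]] := @contained_above R u u6 n un.
  apply: (@box_delaunay_realize R V x y) => //; first by rewrite VN.
  move=> I /Cx[j /subset_leq_card ICj].
  apply: (@le_trans _ _ #|C j|%:R); first by rewrite ler_nat.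
  apply: le_trans (Cm j) _.
  have u32R : 32 <= u%:R :> R by rewrite ler_nat.
  (* Because [n < 2 ^ (10 * u.+1 ^ 2)] and [10 * u.+1 ^ 2 <= (8 * u) ^ 2]. *)
  have sU : Num.sqrt (ln n%:R) <= 8 * u%:R :> R.
    apply: sqrt_ln_le; first by rewrite mulr_ge0.
    apply: (@le_trans _ _ (2 ^+ (10 * u.+1 ^ 2))); first by rewrite -natrX ler_nat ltnW.
    apply: (@le_trans _ _ (expR 1 ^+ (10 * u.+1 ^ 2))).
      by rewrite lerXn2r ?nnegrE ?expR_ge0 // (le_trans _ (expR_ge1Dx 1)).
    rewrite -expRM_natl mulr1 ler_expR natrM natrX -addn1 natrD; nra.
  have cU : c * Num.sqrt (ln n%:R) <= u%:R / 32.
    have c256 : c <= 1 / 256 by nra.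
    by apply: (@le_trans _ _ (c * (8 * u%:R))); [rewrite ler_wpM2l // ltW | nra].
  have q15 : (15 / 16) ^+ u <= expR (- (u%:R / 16)) :> R.
    rewrite -mulrN expRM_natl lerXn2r ?nnegrE ?expR_ge0 //; first by lra.
    by apply: le_trans (expR_ge1Dx _); lra.
  have e2 : 2 <= expR 1 :> R by apply: le_trans (expR_ge1Dx 1); lra.
  apply: (@le_trans _ _ (n%:R * expR (- (c * Num.sqrt (ln n%:R))))); last by rewrite ler_wpM2l.
  apply: (@le_trans _ _ (expR (- (u%:R / 16)) * (2 * n)%:R)).
    by apply: ler_pM => //; rewrite ?exprn_ge0 ?ler_nat //; lra.
  rewrite natrM mulrCA mulrA mulrC ler_wpM2l //.
  (* The factor 2 from [N <= 2 * n] is at most [expR 1], and [1 - u / 16 <= - u / 32] since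
     [u >= 32]. *)
  apply: (@le_trans _ _ (expR 1 * expR (- (u%:R / 16)))).
    by rewrite ler_wpM2r ?expR_ge0.
  by rewrite -expRD ler_expR; lra.
(* For small [n] an increasing chain suffices: its first two points are adjacent, so for [n >= 2] an
   independent set misses a point, and [c] is so small that [n - 1] meets the bound. *)
apply: (@box_delaunay_realize R 'I_n val val); rewrite ?card_ord //.
move=> I /hasse_freeP HI.
apply: (@le_trans _ _ (n%:R * expR (- (c * Num.sqrt (ln n%:R))))); last by rewrite ler_wpM2l.
case: n n1 nn0 s0 pw I HI => [//|[|n]] _ nn0 s0 _ I HI.
  by rewrite ln1 sqrtr0 mulr0 oppr0 expR0 mulr1 ler_nat -[leqRHS]card_ord max_card.
have : (#|I| <= n.+1)%N.
  rewrite leqNgt; apply/negP => cI.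
  have IT : I = [set: 'I_n.+2].
    by apply/eqP; rewrite eqEcard finset.subsetT cardsT card_ord.
  have : ~~ hasse val val (ord0 : 'I_n.+2) (lift ord0 ord0).
    by apply: HI; rewrite IT inE.
  by move=> /negP; apply; apply/hasseP; split=> // w; rewrite /= /bump /=; lia.
rewrite -(ler_nat R) => /le_trans; apply.
have sU : Num.sqrt (ln n.+2%:R) <= n.+2%:R :> R.
  apply: sqrt_ln_le => //; apply: le_trans (expR_ge1Dx _).
  by have := sqr_ge0 (n.+2%:R - 1 : R); nra.
have nn : n.+2%:R <= n0.+1%:R :> R by rewrite ler_nat ltnW // ltnW.
apply: (@le_trans _ _ (n.+2%:R * (1 - c * Num.sqrt (ln n.+2%:R)))).
  have : n.+2%:R * (c * Num.sqrt (ln n.+2%:R)) <= 1 :> R.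
    apply: (@le_trans _ _ (c * (256 * n0.+1%:R ^+ 2))); last by rewrite c1.
    rewrite mulrCA ler_wpM2l ?(ltW c0) //.
    by apply: (@le_trans _ _ (n.+2%:R * n.+2%:R)); [rewrite ler_wpM2l|nra].
  by rewrite -[n.+2]addn1 natrD; lra.
by rewrite ler_wpM2l // expR_ge1Dx.
Qed.

End Bounds.

Theorem theorem1 (R : realType) :
  exists c : R, 0 < c /\
    forall n : nat, (0 < n)%N ->
      exists P : {fset R * R},
        [/\ #|` P|%fset = n,
            (independence_number (box_delaunay P))%:R
              <= n%:R * 2 `^ (- c * Num.sqrt (ln n%:R)) :> R &
            2 `^ (c * Num.sqrt (ln n%:R))
              <= (chromatic_number (box_delaunay P))%:R :> R].
Proof.
have [c [c0 H]] := independence_bound R; exists c; split=> // n n0.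
have [P [Pn Pa]] := H n n0; exists P; split=> //.
have cP : #|box_delaunay P| = n by rewrite -Pn cardfE.
(* The bound on the independence number goes into n <= chi * alpha, and the factor [n] cancels. *)
have := card_le_chromatic_independence (box_delaunay P); rewrite cP -(ler_nat R) natrM.
move: Pa; set s := Num.sqrt _; set a := (independence_number _)%:R.
set q := (chromatic_number _)%:R => Pa nqa.
have n0R : 0 < n%:R :> R by rewrite ltr0n.
have : n%:R <= q * (n%:R * 2 `^ (- c * s)) by apply: le_trans nqa _; rewrite ler_wpM2l.
rewrite mulrCA -[leLHS]mulr1 ler_pM2l // mulNr powRN.
by rewrite ler_pdivlMr ?mul1r // powR_gt0.
Qed.
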